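(* Let $N\ge 2$ be an integer, let $\mathcal{L}_N=\{0,1,\dots,N-1\}^2$, let $d_1(\mathbf i,\mathbf j)=|i_1-j_1|+|i_2-j_2|$ for $\mathbf i=(i_1,i_2),\mathbf j=(j_1,j_2)\in\mathcal{L}_N$, let $K$ be the complete directed graph (without self-loops) on $\mathcal{L}_N$, and let $G_0=(\mathcal{L}_N,E_0)$ with $$E_0=\{(\mathbf i,\mathbf i+\mathbf j):\ \mathbf i\in\mathcal{L}_N,\ \mathbf j\in V_0,\ \mathbf i+\mathbf j\in\mathcal{L}_N\},\qquad V_0=\{(1,0),(0,1),(-1,0),(0,-1)\}.$$ Then $\Gamma_{G_0,d_1}=0$, and hence $F_{G_0,d_1}(b)=F_{K,d_1}(b)$ for every $b:\mathcal{L}_N\to\mathbb{R}$ with $\sum_{\mathbf i\in\mathcal{L}_N} b(\mathbf i)=0$. In particular, $$\mathcal{W}_{d_1}(\mu,\nu)=F_{G_0,d_1}(\mu-\nu)$$ for every pair of probability measures $\mu,\nu$ on $\mathcal{L}_N$.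
   Context: For a finite set $X$, a cost $c:X\times X\to[0,\infty)$ and probability vectors $\mu,\nu$ on $X$, $\mathcal{W}_c(\mu,\nu)=\inf_{\pi\in\Pi(\mu,\nu)}\sum_{(x,y)\in X\times X}c(x,y)\pi(x,y)$, where $\Pi(\mu,\nu)$ is the set of probability measures $\pi$ on $X\times X$ with $\sum_y\pi(x,y)=\mu(x)$ and $\sum_x\pi(x,y)=\nu(y)$ for all $x,y$. For a directed graph $G=(V,E)$ without self-loops, a cost $c$ on edges with values in $[0,\infty)$, and $b:V\to\mathbb{R}$ with $\sum_{v\in V}b(v)=0$, a $b$-flow is a function $f:E\to[0,\infty)$ with $\sum_{v:(u,v)\in E}f(u,v)-\sum_{v:(v,u)\in E}f(v,u)=b(u)$ for all $u\in V$; $\mathcal{F}(G,b)$ is the set of $b$-flows, and $F_{G,c}(b)=\min_{f\in\mathcal{F}(G,b)}\sum_{(u,v)\in E}c(u,v)f(u,v)$. For a directed graph $G$ with vertex set $X$ and a distance $c$ on $X$, $c_G(x,y)$ denotes the minimum, over all directed paths in $G$ from $x$ to $y$, of the sum of the costs $c$ of the edges of the path, and $\Gamma_{G,c}=\max\{1-c(x,y)/c_G(x,y):\ x,y\in X,\ x\neq y\}$. *)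

(* Defs.v *)
From mathcomp Require Import all_boot all_order all_algebra.
From mathcomp Require Import classical_sets reals.

Set Implicit Arguments.
Unset Strict Implicit.
Unset Printing Implicit Defensive.

Import Order.TTheory GRing.Theory Num.Theory.

Local Open Scope classical_set_scope.
Local Open Scope ring_scope.

Definition minimum (R : realType) (x0 : R) (A : set R) : R :=
  xget x0 (A `&` lbound A).

Definition maximum (R : realType) (x0 : R) (A : set R) : R :=
  xget x0 (A `&` ubound A).

Section Transport.
Variables (R : realType) (X : finType).

Definition prob_vector (Y : finType) (p : Y -> R) : Prop :=
  (forall y, 0 <= p y) /\ \sum_y p y = 1.

Definition couplings (mu nu : X -> R) : set (X * X -> R) :=
  [set q | [/\ prob_vector q,
               forall x, \sum_y q (x, y) = mu x
             & forall y, \sum_x q (x, y) = nu y]].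

Definition Wasserstein (c : X -> X -> R) (mu nu : X -> R) : R :=
  inf [set \sum_xy c xy.1 xy.2 * q xy | q in couplings mu nu].

End Transport.

(* A directed graph on X is given by its edge relation G : rel X. *)
Section Flows.
Variables (R : realType) (X : finType) (G : rel X) (c : X -> X -> R).

(* Flows are functions on the edges: only the values f u v with G u v are
   ever read, here and in flow_cost. *)
Definition flows (b : X -> R) : set (X -> X -> R) :=
  [set f | (forall u v, G u v -> 0 <= f u v) /\
           forall u, \sum_(v | G u v) f u v - \sum_(v | G v u) f v u = b u].

Definition flow_cost (f : X -> X -> R) : R :=
  \sum_(e : X * X | G e.1 e.2) c e.1 e.2 * f e.1 e.2.

(* For a nonnegative c, the default -1 is not the cost of any flow, so that
   min_flow_cost b = m with 0 <= m says that the minimum m is attained. *)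
Definition min_flow_cost (b : X -> R) : R :=
  minimum (-1) [set flow_cost f | f in flows b].

Definition path_cost (x : X) (p : seq X) : R := \sum_(r <- pairmap c x p) r.

(* If there is no path from x to y, the default 0 makes 1 - c x y / c_G x y
   equal to 1, which is its value under the convention c_G x y = +oo. *)
Definition path_dist (x y : X) : R :=
  minimum 0 [set path_cost x p | p in [set p | path G x p /\ last x p = y]].

(* When c is a metric all the elements are nonnegative, so that -1 is not
   the maximum of a set that has one. *)
Definition Gamma : R :=
  maximum (-1) [set 1 - c xy.1 xy.2 / path_dist xy.1 xy.2
               | xy in [set xy : X * X | xy.1 <> xy.2]].

End Flows.

Definition complete_graph (X : finType) : rel X := [rel x y | x != y].

Definition lattice (N : nat) : finType := ('I_N * 'I_N)%type.

Definition d1 (R : realType) (N : nat) (i j : lattice N) : R :=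
  `|i.1%:R - j.1%:R| + `|i.2%:R - j.2%:R|.

Definition lattice_pos (N : nat) (i : lattice N) : int * int :=
  (i.1%:Z, i.2%:Z).

Definition V0 : seq (int * int) := [:: (1, 0); (0, 1); (-1, 0); (0, -1)].

Definition G0 (N : nat) : rel (lattice N) :=
  [rel i k | has (fun j => lattice_pos k == lattice_pos i + j) V0].

(* Main.v *)
Require Import Defs.
From mathcomp Require Import all_boot all_order all_algebra.
From mathcomp Require Import classical_sets reals.
From mathcomp Require Import boolp topology normedtype derive.
From mathcomp Require Import zify ring lra.

(** The Manhattan distance [d1] is the path metric of the grid: a staircase from
    [i] to [j] costs exactly [d1 i j] ([G0_geodesic]), and no path costs less by
    the triangle inequality ([path_cost_ge]). So the ratio in [Gamma] is always
    1 and [Gamma] is 0.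

    For the same reason an edge of the complete graph can be replaced by a grid
    path of the same cost. Rerouting every edge of a flow in this way shows that
    the grid and the complete graph have exactly the same set of flow costs for
    each demand ([flow_cost_complete]), hence the same minimum.

    It remains to compare flows on the complete graph with couplings
    ([Wasserstein_flow], for any cost with zero diagonal and the triangle
    inequality). A coupling restricted to the pairs of distinct points is a flow
    with demand [mu - nu] and the same cost ([plan_flow]). A flow, on the other
    hand, may send mass through intermediate points. Adding [mu] on its diagonal
    turns it into a plan between [mu + k] and [nu + k], where [k] is the
    outflow; the common mass [k] is then cancelled point by point, by joining
    what arrives at a point directly to what leaves it, which by the triangle
    inequality does not increase the cost ([cancel_common_mass]). Finally the
    set of couplings is compact, so that the infimum defining the Wasserstein
    cost is attained ([plan_cost_attained]); an optimal coupling then gives an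
    optimal flow. *)

Import Order.TTheory GRing.Theory Num.Theory.
Import numFieldNormedType.Exports.

Local Open Scope classical_set_scope.
Local Open Scope ring_scope.

(** * Minima *)

Lemma minimum_eq (R : realType) (x0 m : R) (A : set R) :
  A m -> lbound A m -> minimum x0 A = m.
Proof.
move=> Am lbm; apply: xget_unique => // y [Ay lby].
by apply/eqP; rewrite eq_le lby//= lbm.
Qed.

Lemma inf_eq (R : realType) (m : R) (A : set R) :
  A m -> lbound A m -> inf A = m.
Proof.
move=> Am lbm; apply/eqP; rewrite eq_le; apply/andP; split.
  by apply: ge_inf Am; exists m.
by apply: lb_le_inf => //; exists m.
Qed.

(** * Geodesics of the grid *)

Lemma path_cost_ge (R : realType) (X : finType) (c : X -> X -> R) x p :
  (forall x, c x x = 0) -> (forall x y z, c x z <= c x y + c y z) ->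
  c x (last x p) <= path_cost c x p.
Proof.
move=> c0 ctri; elim: p x => [|y p IHp] x.
  by rewrite c0 /path_cost big_nil.
rewrite /path_cost /= big_cons -/(path_cost _ _ _).
by apply: le_trans (ctri _ y _) _; rewrite lerD2l.
Qed.

Lemma d1xx (R : realType) (N : nat) (i : lattice N) : d1 R i i = 0.
Proof. by rewrite /d1 !subrr normr0 addr0. Qed.

Lemma d1_triangle (R : realType) (N : nat) (i j k : lattice N) :
  d1 R i k <= d1 R i j + d1 R j k.
Proof.
by rewrite /d1 addrACA lerD ?ler_distD.
Qed.

Lemma d1_gt0 (R : realType) (N : nat) (i j : lattice N) :
  i != j -> 0 < d1 R i j.
Proof.
move=> ij; rewrite lt_def addr_ge0// andbT; apply: contraNN ij.
rewrite paddr_eq0// !normr_eq0 !subr_eq0 !eqr_nat.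
by case: i j => [i1 i2] [j1 j2].
Qed.

Lemma G0E (N : nat) (i k : lattice N) :
  G0 i k = ((k.1 == i.1.+1 :> nat) || (i.1 == k.1.+1 :> nat)) && (k.2 == i.2)
    || (k.1 == i.1) && ((k.2 == i.2.+1 :> nat) || (i.2 == k.2.+1 :> nat)).
Proof.
rewrite /G0 /lattice_pos /= orbF -!pair_eqE /= -!val_eqE /=.
case: i k => [[i1 ?] [i2 ?]] [[k1 ?] [k2 ?]] /=.
by apply/idP/idP; lia.
Qed.

Lemma G0_irreflexive (N : nat) : irreflexive (@G0 N).
Proof. by move=> i; rewrite G0E; lia. Qed.

(** Truncated subtractions in both directions add up to an absolute difference;
    in this form linear arithmetic over the naturals settles the steps along
    a geodesic. *)
Definition lattice_dist {N : nat} (i j : lattice N) : nat :=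
  ((i.1 - j.1) + (j.1 - i.1) + ((i.2 - j.2) + (j.2 - i.2)))%N.

Lemma d1E (R : realType) (N : nat) (i j : lattice N) :
  d1 R i j = (lattice_dist i j)%:R.
Proof.
have dist_nat (m n : nat) : `|m%:R - n%:R| = (m - n + (n - m))%:R :> R.
  wlog le_nm : m n / (n <= m)%N => [hw|].
    by have [/hw//|/ltnW/hw] := leqP n m; rewrite distrC addnC.
  by rewrite -natrB// normr_nat (eqP le_nm) addn0.
by rewrite /d1 !dist_nat -natrD.
Qed.

(** Moving one step towards [j] in a coordinate where [i] and [j] differ stays
    between two points of the square, hence inside it. *)
Lemma G0_neighbour (N : nat) (i j : lattice N) : i != j ->
  exists2 k, G0 i k & lattice_dist i j = (lattice_dist k j).+1.
Proof.
case: i j => [[i1 hi1] [i2 hi2]] [[j1 hj1] [j2 hj2]].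
rewrite -pair_eqE /= -!val_eqE /= => ne_ij.
have [lt1|gt1|eq1] := ltngtP i1 j1.
- have k1 : (i1.+1 < N)%N by lia.
  by exists (Ordinal k1, Ordinal hi2);
    rewrite ?G0E ?/lattice_dist /= -?val_eqE /=; lia.
- have k1 : (i1.-1 < N)%N by lia.
  by exists (Ordinal k1, Ordinal hi2);
    rewrite ?G0E ?/lattice_dist /= -?val_eqE /=; lia.
have [lt2|gt2|eq2] := ltngtP i2 j2; last by lia.
- have k2 : (i2.+1 < N)%N by lia.
  by exists (Ordinal hi1, Ordinal k2);
    rewrite ?G0E ?/lattice_dist /= -?val_eqE /=; lia.
- have k2 : (i2.-1 < N)%N by lia.
  by exists (Ordinal hi1, Ordinal k2);
    rewrite ?G0E ?/lattice_dist /= -?val_eqE /=; lia.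
Qed.

(** Staircase paths: repeated steps towards the target lose nothing against
    the Manhattan distance. *)
Lemma G0_geodesic (R : realType) (N : nat) (i j : lattice N) :
  exists2 p, path (@G0 N) i p /\ last i p = j
    & path_cost (@d1 R N) i p = d1 R i j.
Proof.
have [n] := ubnP (lattice_dist i j); elim: n i => // n IHn i lt_dist.
have [->|/G0_neighbour[k ik dist_ij]] := eqVneq i j.
  by exists [::]; rewrite // /path_cost big_nil d1xx.
have [|p [kp lastp] cp] := IHn k; first by rewrite dist_ij in lt_dist.
exists (k :: p); first by rewrite /= ik.
rewrite /path_cost /= big_cons -/(path_cost _ _ _) cp !d1E dist_ij -natrD.
have -> : lattice_dist i k = 1%N.
  by move: ik; rewrite G0E /lattice_dist -!val_eqE /=; lia.
by rewrite add1n.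
Qed.

Lemma path_dist_G0 (R : realType) (N : nat) (i j : lattice N) :
  path_dist (@G0 N) (@d1 R N) i j = d1 R i j.
Proof.
apply: minimum_eq => [|_ [p [_ <-] <-]].
  by have [p pP <-] := G0_geodesic R N i j; exists p.
by apply: path_cost_ge; [exact: d1xx|exact: d1_triangle].
Qed.

Lemma Gamma_G0 (R : realType) (N : nat) : (2 <= N)%N ->
  Gamma (@G0 N) (@d1 R N) = 0.
Proof.
move=> N_ge2; rewrite /Gamma.
rewrite (_ : [set _ | _ in _] = [set 0]).
  apply: xget_unique => [|y [] //].
  by split=> // y ->.
apply/seteqP; split=> [_ [[i j] /= /eqP ij <-]|_ ->].
  by rewrite path_dist_G0 divff ?subrr// gt_eqF// d1_gt0.
have N_gt0 : (0 < N)%N by exact: ltnW.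
exists ((Ordinal N_gt0, Ordinal N_gt0), (Ordinal N_ge2, Ordinal N_gt0)) => //=.
by rewrite path_dist_G0 divff ?subrr// gt_eqF// d1_gt0.
Qed.

(** * Rerouting flows along geodesics *)

(** The constraints defining flows are linear in the pair of the flow and its
    demand, and the cost is linear too. *)
Lemma flows_sum (R : realType) (X I : finType) (G : rel X) (c : X -> X -> R)
    (P : pred I) (w : I -> R) (b : I -> X -> R) (F : I -> X -> X -> R)
    (f := fun u v => \sum_(i | P i) w i * F i u v) :
  (forall i, P i -> 0 <= w i) -> (forall i, P i -> flows G (b i) (F i)) ->
  flows G (fun u => \sum_(i | P i) w i * b i u) f /\
  flow_cost G c f = \sum_(i | P i) w i * flow_cost G c (F i).
Proof.
move=> w_ge0 Fb; split; first split=> [u v uv|u].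
- apply: sumr_ge0 => i Pi; apply: mulr_ge0 (w_ge0 _ Pi) _.
  exact: (Fb i Pi).1.
- rewrite /f [in X in X - _]exchange_big [in X in _ - X]exchange_big -sumrB.
  apply: eq_bigr => i Pi; rewrite -!mulr_sumr -mulrBr.
  by rewrite (Fb i Pi).2.
- rewrite /flow_cost; under eq_bigr do rewrite mulr_sumr.
  rewrite exchange_big; apply: eq_bigr => i Pi; rewrite mulr_sumr.
  by apply: eq_bigr => e _; rewrite mulrCA.
Qed.

Definition unit_demand {R : realType} {X : finType} (x y u : X) : R :=
  (u == x)%:R - (u == y)%:R.

(** Sending one unit along a path. The path may repeat edges, so the flow adds
    up one indicator per step, and its cost still is that of the path. *)
Lemma path_flow (R : realType) (X : finType) (G : rel X) (c : X -> X -> R) x p :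
  path G x p -> exists2 f : X -> X -> R, flows G (unit_demand x (last x p)) f
    & flow_cost G c f = path_cost c x p.
Proof.
elim: p x => [|y p IHp] x /=.
  exists (fun _ _ => 0); last first.
    rewrite /path_cost big_nil /flow_cost big1// => e _; exact: mulr0.
  by split=> // u; rewrite !big1// /unit_demand !subrr.
move=> /andP[xy /IHp[f [f_ge0 fb] cf]].
pose e u v : R := ((u == x) && (v == y))%:R.
have e_out u : \sum_(v | G u v) e u v = (u == x)%:R.
  rewrite /e; case: eqP => [->|_] /=; last by rewrite big1.
  by rewrite (bigD1 y)//= eqxx big1 ?addr0// => v /andP[_ /negPf->].
have e_in u : \sum_(v | G v u) e v u = (u == y)%:R.
  rewrite /e; case: eqP => [->|_] /=; last first.
    by rewrite big1// => v _; rewrite andbF.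
  by rewrite (bigD1 x)//= eqxx big1 ?addr0// => v /andP[_ /negPf->].
exists (fun u v => e u v + f u v).
  split=> [u v uv|u]; first by rewrite addr_ge0 ?f_ge0 ?ler0n.
  rewrite !big_split/= e_out e_in opprD addrACA fb /unit_demand.
  by rewrite addrA subrK.
rewrite /path_cost /= big_cons -/(path_cost c y p) -cf /flow_cost.
under eq_bigr do rewrite mulrDr; rewrite big_split/=; congr (_ + _).
rewrite (bigD1 (x, y))//= /e !eqxx mulr1 big1 ?addr0// => -[u v] /andP[_].
by rewrite -pair_eqE /= => /negPf->; rewrite mulr0.
Qed.

(** A flow on [G] is a flow on the complete graph that vanishes outside [G].
    Conversely, a flow on the complete graph is a combination of unit demands
    [x -> y] with weights [f x y]; each is routed in [G] along a path with
    the cost of the edge it replaces. The two sets of achievable costs being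
    equal, so are their minima, whether or not these are attained. *)
Lemma flow_cost_complete (R : realType) (X : finType) (G : rel X)
    (c : X -> X -> R) (b : X -> R) :
  irreflexive G ->
  (forall x y, x != y -> exists2 p, path G x p /\ last x p = y
                                  & path_cost c x p = c x y) ->
  [set flow_cost G c f | f in flows G b] =
  [set flow_cost (@complete_graph X) c f | f in flows (@complete_graph X) b].
Proof.
move=> Girr geo; apply/seteqP; split=> _ [f [f_ge0 fb] <-].
  pose g u v := if G u v then f u v else 0.
  have G_neq u v : G u v -> u != v by apply: contraTneq => ->; rewrite Girr.
  have drop_edges (I : finType) (P Q : pred I) (F : I -> R) :
      (forall i, Q i -> P i) ->
      \sum_(i | P i) (if Q i then F i else 0) = \sum_(i | Q i) F i.
    move=> QP; rewrite -big_mkcondr; apply: eq_bigl => i.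
    by apply/andP/idP => [[]|Qi]//; split=> //; exact: QP.
  exists g.
    split=> [u v _|u]; first by rewrite /g; case: ifP => // /f_ge0.
    rewrite -fb /g drop_edges ?drop_edges// => v; rewrite /complete_graph /=.
      exact: G_neq.
    exact: G_neq.
  rewrite /flow_cost -[RHS](drop_edges _
    (fun e : X * X => complete_graph e.1 e.2)) => [|[u v] /G_neq//].
  by apply: eq_bigr => -[u v] _; rewrite /g /=; case: ifP => // _;
    rewrite mulr0.
have [F FP] : {F : X * X -> X -> X -> R & forall xy, xy.1 != xy.2 ->
    flows G (unit_demand xy.1 xy.2) (F xy) /\
    flow_cost G c (F xy) = c xy.1 xy.2}.
  apply: (@choice _ _ (fun (xy : X * X) (g : X -> X -> R) => xy.1 != xy.2 ->
    flows G (unit_demand xy.1 xy.2) g /\ flow_cost G c g = c xy.1 xy.2)).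
  move=> -[x y] /=; have [|/geo[p [xp py] cp]] := eqVneq x y.
    by exists (fun _ _ => 0).
  have [g gb cg] := path_flow _ _ _ c _ _ xp; exists g => _.
  by rewrite -py cg cp py -[X in unit_demand x X]py.
have [||gb cg] := @flows_sum R X _ G c (fun xy : X * X => xy.1 != xy.2)
  (fun xy => f xy.1 xy.2) (fun xy => unit_demand xy.1 xy.2) F.
- by move=> xy /f_ge0.
- by move=> xy /FP[].
exists (fun u v => \sum_(xy : X * X | xy.1 != xy.2) f xy.1 xy.2 * F xy u v).
  case: gb => g_ge0 gb; split=> // u; rewrite gb -fb.
  rewrite /unit_demand; under eq_bigr do rewrite mulrBr; rewrite sumrB.
  (* The demands of the edges, weighted by [f], add up to the demand of [f]:
     only the edges that start or end at [u] contribute at [u]. *)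
  have at_vertex (h : X -> X -> R) :
      \sum_x \sum_(y | x != y) h x y * (u == x)%:R = \sum_(y | u != y) h u y.
    rewrite (bigD1 u)//= [X in _ + X]big1 ?addr0 => [|x /negPf xu].
      by under eq_bigr do rewrite eqxx mulr1.
    by rewrite big1// => y _; rewrite eq_sym xu mulr0.
  congr (_ - _).
    rewrite -(pair_big_dep xpredT (fun x y => x != y)
      (fun x y => f x y * (u == x)%:R)) /=.
    exact: at_vertex.
  rewrite -(pair_big_dep xpredT (fun x y => x != y)
    (fun x y => f x y * (u == y)%:R)) /=.
  rewrite (exchange_big_dep xpredT)//=.
  under [RHS]eq_bigl do rewrite /complete_graph /= eq_sym.
  rewrite -(at_vertex (fun x y => f y x)); apply: eq_bigr => y _.
  by apply: eq_bigl => x; rewrite eq_sym.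
rewrite cg; apply: eq_bigr => xy /FP[_ ->]; exact: mulrC.
Qed.

(** * Transport plans and their optima *)

(** Couplings without normalisation of the total mass: the intermediate
    objects in the argument carry more mass than a probability. *)
Definition plans {R : realType} {X : finType} (mu nu : X -> R) :
    set (X * X -> R) :=
  [set q | [/\ forall xy, 0 <= q xy,
               forall x, \sum_y q (x, y) = mu x
             & forall y, \sum_x q (x, y) = nu y]].

Definition plan_cost {R : realType} {X : finType} (c : X -> X -> R)
  (q : X * X -> R) : R := \sum_xy c xy.1 xy.2 * q xy.

Lemma couplings_plans (R : realType) (X : finType) (mu nu : X -> R) :
  prob_vector mu -> couplings mu nu = plans mu nu.
Proof.
move=> [_ mu1]; apply/seteqP; split => q [].
  by move=> [q0 _] qmu qnu; split.
move=> q0 qmu qnu; split => //; split=> //.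
rewrite -mu1 -(eq_bigr _ (fun x _ => qmu x)) pair_bigA /=.
by apply: eq_bigr => -[].
Qed.

(** The entries of a plan lie between [0] and the row sums, so plans form a
    closed subset of a product of segments, which is compact by Tychonoff's
    theorem, and the cost is continuous on it. *)
Lemma plan_cost_attained (R : realType) (X : finType) (c : X -> X -> R)
    (mu nu : X -> R) :
  plans mu nu !=set0 ->
  exists2 q, plans mu nu q
    & forall q', plans mu nu q' -> plan_cost c q <= plan_cost c q'.
Proof.
move=> plans0.
pose T : topologicalType := {ptws (X * X)%type -> R}.
have proj_cont (xy : X * X) : continuous (fun q : T => q xy : R).
  exact: (@proj_continuous _ (fun=> R)).
have sum_cont (I : finType) (F : I -> T -> R) : (forall i, continuous (F i)) ->
    continuous (fun q : T => \sum_i F i q).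
  by move=> F_cont; apply: continuous_big => //; exact: add_continuous.
have closed_eqs (F : X -> T -> R) a : (forall x, continuous (F x)) ->
    closed [set q : T | forall x, F x q = a x].
  move=> F_cont.
  rewrite (_ : [set _ | _] = \bigcap_(x in setT) F x @^-1` [set r | r = a x]).
    apply: closed_bigI => x _; apply: preimage_closed => //; exact: closed_eq.
  by apply/seteqP; split=> q /= qa x => [_|]; apply: qa.
have box_compact : compact [set q : T | forall xy, [set` `[0, mu xy.1]] (q xy)].
  by apply: (@tychonoff _ (fun=> R) (fun xy => [set` `[0, mu xy.1]])) => xy;
    exact: segment_compact.
have plansE : plans mu nu =
    [set q : T | forall xy, [set` `[0, mu xy.1]] (q xy)] `&`
    ([set q : T | forall x, \sum_y q (x, y) = mu x] `&`
     [set q : T | forall y, \sum_x q (x, y) = nu y]).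
  apply/seteqP; split => q /=.
    move=> [q0 qmu qnu]; split=> // -[x y] /=; rewrite in_itv/= q0/=.
    by rewrite -qmu (bigD1 y) //= lerDl sumr_ge0.
  by move=> [qbox [qmu qnu]]; split=> // xy; have /andP[] := qbox xy.
have plans_compact : compact (plans mu nu : set T).
  rewrite plansE; apply: compact_closedI => //.
  by apply: closedI; apply: closed_eqs => x; apply: sum_cont => y;
    exact: proj_cont.
have cost_cont : continuous (plan_cost c : T -> R).
  apply: (sum_cont _ (fun xy (q : T) => c xy.1 xy.2 * q xy)) => xy q.
  exact: (cvgM (cvg_cst _) (proj_cont xy q)).
have [|q /set_mem qP qmin] :=
    @compact_EVT_min T R (plan_cost c) _ plans0 plans_compact.
  exact: continuous_subspaceT.
by exists q => // q' /mem_set; exact: qmin.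
Qed.

(** The independent plan [a x * b y / t], with [t] the common mass. When
    [t = 0] both marginals vanish and so does the formula, since [0^-1 = 0]. *)
Lemma plans_neq0 (R : realType) (X : finType) (a b : X -> R) :
  (forall x, 0 <= a x) -> (forall y, 0 <= b y) ->
  \sum_x a x = \sum_y b y -> plans a b !=set0.
Proof.
move=> a_ge0 b_ge0 ab; pose t := \sum_x a x.
have shareE (s : X -> R) x : (forall x, 0 <= s x) -> \sum_x s x = t ->
    s x * (t / t) = s x.
  move=> s_ge0 st; have [t0|t0] := eqVneq t 0; last by rewrite divff// mulr1.
  rewrite t0 mul0r mulr0; apply/esym/eqP; move: st; rewrite t0.
  by move/eqP; rewrite psumr_eq0// => /allP; apply; rewrite mem_index_enum.
exists (fun xy => a xy.1 * b xy.2 / t); split=> [xy|x|y] /=.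
- by rewrite !(mulr_ge0, invr_ge0) ?sumr_ge0.
- by rewrite -mulr_suml -mulr_sumr -ab -/t -mulrA shareE.
- by rewrite -!mulr_suml -/t -mulrA mulrCA shareE.
Qed.

(** * Cancelling mass common to both marginals *)

(** Taking [t / S] of each entry, where [S] is the sum. When [S = 0] also
    [t = 0], in agreement with [0^-1 = 0]. *)
Lemma share_of_total (R : realType) (X : finType) (s : X -> R) (t : R) :
  (forall x, 0 <= s x) -> 0 <= t <= \sum_x s x ->
  exists2 a : X -> R, forall x, 0 <= a x <= s x & \sum_x a x = t.
Proof.
move=> s_ge0 /andP[t_ge0 t_le]; pose S := \sum_x s x.
have S_ge0 : 0 <= S by exact: sumr_ge0.
exists (fun x => s x * (t / S)) => [x|].
  rewrite mulr_ge0 ?divr_ge0//= ler_piMr//.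
  have [->|S_neq0] := eqVneq S 0; first by rewrite invr0 mulr0.
  by rewrite ler_pdivrMr ?mul1r// lt_def S_neq0.
rewrite -mulr_suml -/S mulrCA.
have [S0|S_neq0] := eqVneq S 0; last by rewrite divff ?mulr1.
by rewrite S0 mul0r mulr0; apply/eqP; rewrite eq_le t_ge0 -S0.
Qed.

(** Mass [t] that enters [w] and leaves it again need not stop there: remove a
    share [a] of total [t] from what enters [w], a share [b] of total [t] from
    what leaves it, and join them directly by a plan [r] with marginals [a] and
    [b]. By the triangle inequality this does not increase the cost. As
    [q (w, w) = 0], no mass is removed twice at [(w, w)]. *)
Lemma cancel_transit (R : realType) (X : finType) (c : X -> X -> R)
    (mu nu : X -> R) (w : X) (t : R) (q : X * X -> R) :
  (forall x y z, c x z <= c x y + c y z) ->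
  (forall x, 0 <= mu x) -> (forall x, 0 <= nu x) -> 0 <= t -> q (w, w) = 0 ->
  plans (fun x => mu x + t *+ (x == w)) (fun x => nu x + t *+ (x == w)) q ->
  exists2 q', plans mu nu q' & plan_cost c q' <= plan_cost c q.
Proof.
move=> ctri mu_ge0 nu_ge0 t_ge0 qww [q_ge0 qmu qnu].
have [||a a_le a_sum] := @share_of_total R X (fun x => q (x, w)) t => //.
  by rewrite t_ge0/= qnu eqxx mulr1n lerDr.
have [||b b_le b_sum] := @share_of_total R X (fun y => q (w, y)) t => //.
  by rewrite t_ge0/= qmu eqxx mulr1n lerDr.
have a_ge0 x : 0 <= a x by case/andP: (a_le x).
have b_ge0 x : 0 <= b x by case/andP: (b_le x).
have aw : a w = 0 by apply/eqP; rewrite eq_le -{1}qww andbC a_le.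
have bw : b w = 0 by apply/eqP; rewrite eq_le -{1}qww andbC b_le.
have [|r [r_ge0 ra rb]] := @plans_neq0 R X a b a_ge0 b_ge0.
  by rewrite a_sum.
have sum_delta (F : X -> R) : \sum_x F x *+ (x == w) = F w.
  by rewrite (bigD1 w)//= eqxx big1 ?addr0// => x /negPf->.
exists (fun xy => q xy - a xy.1 *+ (xy.2 == w) - b xy.2 *+ (xy.1 == w) + r xy).
  split=> [[u v]|x|y] /=.
  - apply: addr_ge0 => //.
    case: (eqVneq v w) => [->|_]; case: (eqVneq u w) => [->|_].
    + by rewrite qww aw bw !mul0rn !subr0.
    + by rewrite subr0 subr_ge0; case/andP: (a_le u).
    + by rewrite subr0 subr_ge0; case/andP: (b_le v).
    + by rewrite !subr0.
  - rewrite big_split/= !sumrB qmu ra sum_delta sumrMnl b_sum; ring.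
  - rewrite big_split/= !sumrB qnu rb sum_delta sumrMnl a_sum; ring.
(* As [a] and [b] are the marginals of [r], the cost removed is that of the
   detours through [w] of the mass described by [r]. *)
have cost_a : \sum_xy c xy.1 xy.2 * (a xy.1 *+ (xy.2 == w)) =
    \sum_xy c xy.1 w * r xy.
  rewrite -(pair_bigA _ (fun x y => c x y * (a x *+ (y == w)))) /=.
  rewrite [RHS](eq_bigr (fun xy => c xy.1 w * r (xy.1, xy.2))); last by case.
  rewrite -(pair_bigA _ (fun x y => c x w * r (x, y))) /=.
  apply: eq_bigr => x _; rewrite -mulr_sumr ra.
  by rewrite -(sum_delta (fun y => c x y * a x));
    under eq_bigr do rewrite mulrnAr.
have cost_b : \sum_xy c xy.1 xy.2 * (b xy.2 *+ (xy.1 == w)) =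
    \sum_xy c w xy.2 * r xy.
  rewrite -(pair_bigA _ (fun x y => c x y * (b y *+ (x == w)))) /=.
  rewrite [RHS](eq_bigr (fun xy => c w xy.2 * r (xy.1, xy.2))); last by case.
  rewrite -(pair_bigA _ (fun x y => c w y * r (x, y))) /=.
  rewrite exchange_big [RHS]exchange_big; apply: eq_bigr => y _ /=.
  rewrite -mulr_sumr rb.
  by rewrite -(sum_delta (fun x => c x y * b y));
    under eq_bigr do rewrite mulrnAr.
rewrite /plan_cost; under eq_bigr do rewrite mulrDr !mulrBr.
rewrite big_split/= !sumrB cost_a cost_b -!addrA gerDl addrA.
rewrite -opprD -big_split addrC subr_le0; apply: ler_sum => xy _ /=.
by rewrite -mulrDl ler_wpM2r.
Qed.

(** Mass sitting at [(w, w)] costs nothing, so it can be cancelled for free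
    until either [t] or the diagonal entry is exhausted; the rest is transit
    through [w]. *)
Lemma cancel_mass_at (R : realType) (X : finType) (c : X -> X -> R)
    (mu nu : X -> R) (w : X) (t : R) (q : X * X -> R) :
  (forall x, c x x = 0) -> (forall x y z, c x z <= c x y + c y z) ->
  (forall x, 0 <= mu x) -> (forall x, 0 <= nu x) -> 0 <= t ->
  plans (fun x => mu x + t *+ (x == w)) (fun x => nu x + t *+ (x == w)) q ->
  exists2 q', plans mu nu q' & plan_cost c q' <= plan_cost c q.
Proof.
move=> c0 ctri mu_ge0 nu_ge0 t_ge0 [q_ge0 qmu qnu].
pose s := Num.min t (q (w, w)).
pose q1 xy := q xy - s *+ (xy == (w, w)).
have s_le : s <= q (w, w) by rewrite ge_min lexx orbT.
have q1_plan : plans (fun x => mu x + (t - s) *+ (x == w))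
                     (fun x => nu x + (t - s) *+ (x == w)) q1.
  split=> [xy|x|y]; rewrite /q1.
  - by case: eqP => [->|_]; rewrite ?subr0// subr_ge0.
  - rewrite sumrB qmu mulrnBl -addrA; congr (_ + (_ - _)).
    under eq_bigr do rewrite xpair_eqE.
    case: (x == w); last by rewrite big1.
    by rewrite (bigD1 w)//= eqxx big1 ?addr0// => y /negPf->.
  - rewrite sumrB qnu mulrnBl -addrA; congr (_ + (_ - _)).
    under eq_bigr do rewrite xpair_eqE andbC.
    case: (y == w); last by rewrite big1.
    by rewrite (bigD1 w)//= eqxx big1 ?addr0// => x /negPf->.
have q1_cost : plan_cost c q1 = plan_cost c q.
  apply: eq_bigr => -[x y] _; rewrite /q1 mulrBr xpair_eqE /=.
  by case: eqP => [->|_]; case: eqP => [->|_] /=;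
    rewrite ?c0 ?mulr0n ?mulr0 ?mul0r ?subr0.
rewrite -q1_cost; have [t_le|q_lt] := leP t (q (w, w)).
  exists q1 => //; case: q1_plan => q1_ge0 q1mu q1nu; split=> // x.
    by rewrite q1mu /s min_l// subrr mul0rn addr0.
  by rewrite q1nu /s min_l// subrr mul0rn addr0.
apply: cancel_transit q1_plan => //; first by rewrite subr_ge0 ge_min lexx.
by rewrite /q1 eqxx /s min_r ?subrr// ltW.
Qed.

(** The vertices are treated one at a time: for a list containing the support
    of [k], cancelling at its head leaves a [k] supported in its tail. *)
Lemma cancel_common_mass (R : realType) (X : finType) (c : X -> X -> R)
    (mu nu k : X -> R) (q : X * X -> R) :
  (forall x, c x x = 0) -> (forall x y z, c x z <= c x y + c y z) ->
  (forall x, 0 <= mu x) -> (forall x, 0 <= nu x) -> (forall x, 0 <= k x) ->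
  plans (fun x => mu x + k x) (fun x => nu x + k x) q ->
  exists2 q', plans mu nu q' & plan_cost c q' <= plan_cost c q.
Proof.
move=> c0 ctri mu_ge0 nu_ge0.
have : forall x, x \notin enum X -> k x = 0 by move=> x; rewrite mem_enum.
elim: (enum X) k q => [|w s IHs] k q k_supp k_ge0.
  move=> [q_ge0 qmu qnu]; exists q => //.
  by split=> // x; rewrite ?qmu ?qnu k_supp// addr0.
pose k' x := if x == w then 0 else k x.
have k'_ge0 x : 0 <= k' x by rewrite /k'; case: ifP.
have kE x : k x = k' x + k w *+ (x == w).
  by rewrite /k'; case: eqP => [->|_]; rewrite ?add0r ?addr0.
move=> [q_ge0 qmu qnu].
have [||||||q1 q1_plan q1_cost] := @cancel_mass_at R X c (fun x => mu x + k' x)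
    (fun x => nu x + k' x) w (k w) q => //.
- by move=> x; exact: addr_ge0.
- by move=> x; exact: addr_ge0.
- by split=> // x; rewrite ?qmu ?qnu kE addrA.
have [|||q2 q2_plan q2_cost] := IHs k' q1 => //.
  move=> x xs; rewrite /k'; case: eqP => // /eqP xw.
  by apply: k_supp; rewrite inE negb_or xw.
by exists q2 => //; exact: le_trans q1_cost.
Qed.

(** * Flows on the complete graph and transport plans *)

(** A flow becomes a plan by letting the mass [mu] wait on the diagonal. The
    marginals then exceed [mu] and [nu] by the same amount, the outflow [k] at
    each vertex, which can be cancelled. *)
Lemma flow_plan (R : realType) (X : finType) (c : X -> X -> R)
    (mu nu : X -> R) (f : X -> X -> R) :
  (forall x, c x x = 0) -> (forall x y z, c x z <= c x y + c y z) ->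
  (forall x, 0 <= mu x) -> (forall x, 0 <= nu x) ->
  flows (@complete_graph X) (fun x => mu x - nu x) f ->
  exists2 q, plans mu nu q &
             plan_cost c q <= flow_cost (@complete_graph X) c f.
Proof.
move=> c0 ctri mu_ge0 nu_ge0 [f_ge0 fb].
pose q xy := if xy.1 == xy.2 then mu xy.1 else f xy.1 xy.2.
have -> : flow_cost (@complete_graph X) c f = plan_cost c q.
  rewrite /flow_cost big_mkcond; apply: eq_bigr => -[x y] _.
  by rewrite /q /complete_graph /=; case: eqP => [->|]; rewrite ?c0 ?mul0r.
pose k x := \sum_(y | complete_graph x y) f x y.
apply: (@cancel_common_mass R X c mu nu k) => //.
  by move=> x; apply: sumr_ge0 => y; exact: f_ge0.
split=> [[x y]|x|y]; rewrite /q /=.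
- by case: eqP => // /eqP; exact: f_ge0.
- rewrite (bigD1 x)//= eqxx; congr (_ + _).
  under eq_bigl do rewrite eq_sym.
  by apply: eq_bigr => y /negPf->.
- have -> : nu y + k y = mu y + \sum_(x | complete_graph x y) f x y.
    by have := fb y; rewrite -/(k y); lra.
  rewrite (bigD1 y)//= eqxx; congr (_ + _).
  by apply: eq_bigr => x /negPf->.
Qed.

(** Off its diagonal a plan is a flow: the diagonal entries cost nothing and
    contribute equally to both marginals. *)
Lemma plan_flow (R : realType) (X : finType) (c : X -> X -> R)
    (mu nu : X -> R) (q : X * X -> R) (f := fun x y => q (x, y)) :
  (forall x, c x x = 0) -> plans mu nu q ->
  flows (@complete_graph X) (fun x => mu x - nu x) f /\
  flow_cost (@complete_graph X) c f = plan_cost c q.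
Proof.
move=> c0 [q_ge0 qmu qnu]; split; first split=> [u v _|x]; first exact: q_ge0.
  rewrite /= -qmu -qnu.
  rewrite [\sum_y q (x, y)](bigD1 x)//= [\sum_y q (y, x)](bigD1 x)//=.
  rewrite opprD addrACA subrr add0r; congr (_ - _).
  by apply: eq_bigl => y; rewrite /complete_graph /= eq_sym.
rewrite /flow_cost big_mkcond; apply: eq_bigr => -[x y] _.
by rewrite /f /complete_graph /=; case: eqP => [->|]; rewrite ?c0 ?mul0r.
Qed.

(** Plans and flows with demand [mu - nu] have the same costs up to a decrease,
    and the optimal plan exists, so that the infimum over couplings is the
    minimum over flows. *)
Lemma Wasserstein_flow (R : realType) (X : finType) (c : X -> X -> R)
    (mu nu : X -> R) :
  (forall x, c x x = 0) -> (forall x y z, c x z <= c x y + c y z) ->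
  prob_vector mu -> prob_vector nu ->
  Wasserstein c mu nu
  = min_flow_cost (@complete_graph X) c (fun x => mu x - nu x).
Proof.
move=> c0 ctri mu_prob [nu_ge0 nu1]; have [mu_ge0 mu1] := mu_prob.
have [|q q_plan q_min] := @plan_cost_attained R X c mu nu.
  by apply: plans_neq0 => //; rewrite mu1.
rewrite /Wasserstein couplings_plans//.
rewrite (@inf_eq _ (plan_cost c q)); [|by exists q|]; last first.
  by move=> _ [q' q'_plan <-]; exact: q_min.
apply/esym/minimum_eq => [|_ [f fb <-]].
  have [fb <-] := @plan_flow R X c mu nu q c0 q_plan.
  by exists (fun x y => q (x, y)).
have [q' q'_plan] := @flow_plan R X c mu nu f c0 ctri mu_ge0 nu_ge0 fb.
by apply: le_trans; exact: q_min.
Qed.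

(** * Wasserstein distance as a flow cost on the grid *)

Theorem proposition3p1 (R : realType) (N : nat) (hN : (2 <= N)%N) :
  [/\ Gamma (@G0 N) (@d1 R N) = 0,
      forall b : lattice N -> R, \sum_i b i = 0 ->
        min_flow_cost (@G0 N) (@d1 R N) b
        = min_flow_cost (@complete_graph (lattice N)) (@d1 R N) b
    & forall mu nu : lattice N -> R, prob_vector mu -> prob_vector nu ->
        Wasserstein (@d1 R N) mu nu
        = min_flow_cost (@G0 N) (@d1 R N) (fun i => mu i - nu i)].
Proof.
have min_flowE (b : lattice N -> R) : min_flow_cost (@G0 N) (@d1 R N) b
    = min_flow_cost (@complete_graph (lattice N)) (@d1 R N) b.
  congr minimum; apply: flow_cost_complete; first exact: G0_irreflexive.
  by move=> i j _; exact: G0_geodesic.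
split=> [|b _|mu nu mu_prob nu_prob]; [exact: Gamma_G0|exact: min_flowE|].
by rewrite min_flowE Wasserstein_flow//; [exact: d1xx|exact: d1_triangle].
Qed.
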